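(* Let $m$ be a positive integer, $D$ a square-free positive integer, and $t$ the number of distinct prime factors of $D$. For $Q>1$ let $\mathcal{F}_{m,D}(Q)$ be the set of polynomials $f(x)=\sum_{k=0}^{2m}c_kx^k\in\mathbb{Z}[x]$ with $c_k=c_{2m-k}$ for all $k$ and $c_0=c_{2m}=1$, such that (i) $f$ is irreducible over $\mathbb{Q}$; (ii) $f(1)f(-1)=-Dk^2$ for some $k\in\mathbb{Q}$; (iii) $f$ has distinct roots $\lambda,\lambda^{-1},\mu_1,\mu_1^{-1},\dots,\mu_{m-1},\mu_{m-1}^{-1}$ where $\lambda\in\mathbb{R}$ with $1<\lambda\le Q$ and each $\mu_i\notin\mathbb{R}$ with $|\mu_i|=1$. Then \[ \#\mathcal{F}_{m,D}(Q)\le\frac{\kappa(m,D)}{\pi\sqrt D}Q^{m-1}\log Q+O(Q^{m-1}), \] where \[ \kappa(m,D)=\begin{cases}2^{t+2m}\kappa_0(m)&\text{if $D$ is odd},\\ 3\cdot 2^{t+2m-2}\kappa_0(m)&\text{if $D$ is even},\end{cases} \] and \[ \kappa_0(m)=\begin{cases}\dfrac{2^{(m-1)(m-2)}(2^{2m}-4)^{\frac m2-1}}{\left((\frac m2-1)!\right)^2}&\text{if $m$ is even},\\[2ex] \dfrac{2^{(2m-1)(\frac{m-1}{2})}(2^{2m-1}-2)^{\frac{m-3}{2}}}{\left((\frac{m-1}{2})!\right)^2}&\text{if $m$ is odd}.\end{cases} \]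
   Context: A Salem number is a real algebraic integer $\lambda>1$ all of whose Galois conjugates other than $\lambda^{-1}$ have absolute value $1$; the set $\mathcal{F}_{m,D}(Q)$ is exactly the set of minimal polynomials of degree $2m$ of Salem numbers $\lambda\le Q$ (equivalently, Mahler measure $\le Q$) with $f(1)f(-1)\equiv -D$ in $\mathbb{Q}^\times/\mathbb{Q}^{\times2}$.
   Formalization: The case m = 1 is excluded, since there κ_0(1) contains the factor (2^1−2)^{−1} = 0^{−1} and the stated bound is undefined; the theorem is proved for all m ≥ 2. *)

(* Defs.v *)
From HB Require Import structures.
From mathcomp Require Import all_boot all_order all_algebra finmap.
From mathcomp Require Import all_classical all_reals all_analysis.
From mathcomp Require Import complex.

Set Implicit Arguments.
Unset Strict Implicit.
Unset Printing Implicit Defensive.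

Import Order.TTheory GRing.Theory Num.Theory.

Local Open Scope classical_set_scope.
Local Open Scope ring_scope.

Definition squarefree (D : nat) : Prop :=
  forall d : nat, (d ^ 2 %| D)%N -> d = 1%N.

Definition reciprocal_of (m : nat) (f : {poly int}) : Prop :=
  [/\ (size f <= (2 * m).+1)%N,
      forall k : nat, (k <= 2 * m)%N -> f`_k = f`_(2 * m - k),
      f`_0 = 1 & f`_(2 * m) = 1].

Definition root_list (R : realType) (n : nat) (lambda : R)
    (mu : 'I_n -> R[i]) : seq R[i] :=
  [:: lambda%:C; (lambda^-1)%:C]%C
    ++ [seq mu i | i : 'I_n] ++ [seq (mu i)^-1 | i : 'I_n].

Definition salem_roots (R : realType) (m : nat) (Q : R) (f : {poly int}) : Prop :=
  exists (lambda : R) (mu : 'I_(m - 1) -> R[i]),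
    [/\ 1 < lambda, lambda <= Q,
        forall i, mu i \isn't Num.real,
        forall i, `|mu i| = 1
      & uniq (root_list lambda mu) /\
        forall z : R[i],
          root (map_poly intr f) z = (z \in root_list lambda mu)].

Definition Fset (R : realType) (m D : nat) (Q : R) : set {poly int} :=
  [set f | [/\ reciprocal_of m f,
               irreducible_poly (map_poly intr f : {poly rat}),
               exists k : rat, (f.[1] * f.[-1])%:~R = - (D%:R * k ^+ 2)
             & salem_roots m Q f]].

(* The exponents are natural-number expressions: [./2] is an exact division in
   each branch, and no subtraction truncates as soon as [m >= 2].  At [m = 1]
   the formula is [0 ^ -1 / 1], hence undefined, and the value [kappa0 1]
   computed below is meaningless. *)
Definition kappa0 (R : realType) (m : nat) : R :=
  if odd m then
    2 ^+ ((2 * m - 1) * (m - 1)./2)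
      * (2 ^+ (2 * m - 1) - 2) ^+ (m - 3)./2 / (((m - 1)./2)`!%:R) ^+ 2
  else
    2 ^+ ((m - 1) * (m - 2)) * (2 ^+ (2 * m) - 4) ^+ (m./2 - 1)
      / ((m./2 - 1)`!%:R) ^+ 2.

Definition kappa (R : realType) (m D : nat) : R :=
  let t := size (primes D) in
  if odd D then 2 ^+ (t + 2 * m) * kappa0 R m
  else 3 * 2 ^+ (t + 2 * m - 2) * kappa0 R m.

(* Main.v *)
(* Write [f(x) = x^m g(x + 1/x)]. The trace polynomial [g] has one root
   [alpha = lambda + 1/lambda <= Q + 1] above [2] and all others in [(-2, 2)],
   so [a = -f(1) = -g(2)] and [b = f(-1) = |g(-2)|] are positive, at most
   [4^(m-1) (Q + 3)], and the coefficients of [g] are at most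
   [3^(m-1) (Q + 2)] in absolute value. The pair [(a, b)] and the [m - 2]
   coefficients of [g] of degrees [2, .., m-1] determine [f].
   As [a b = D k^2] with [D] squarefree, [a = c e x^2] and [b = d e y^2] with
   [c d = D] and [e] prime to [D], hence odd when [D] is even. So at most
   [2^t (N / sqrt D) sum 1/e] pairs are bounded by [N], the sum being over all
   [e <= N], or over the odd ones when [D] is even. Both parities of [m] give
   [kappa0(m) >= 4^((m-1)(m-2)) 2^h / h!^2] with [h = floor((m-1)/2)], which
   exceeds [(2 * 3^(m-1))^(m-2)], and [pi <= 4] absorbs what remains. *)

Require Import Defs.
From HB Require Import structures.
From mathcomp Require Import all_boot all_order all_algebra finmap.
From mathcomp Require Import all_classical all_reals all_analysis.
From mathcomp Require Import complex.
From mathcomp Require Import zify ring lra.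

Set Implicit Arguments.
Unset Strict Implicit.
Unset Printing Implicit Defensive.

Import Order.TTheory GRing.Theory Num.Theory.
Local Open Scope classical_set_scope.
Local Open Scope ring_scope.

(** * Squarefree numbers *)

Lemma squarefree_lognP (n : nat) :
  squarefree n <-> (0 < n)%N /\ forall p, (logn p n <= 1)%N.
Proof.
split=> [sqn|[n0 nlog] d dn].
  have n0 : (0 < n)%N by case: n sqn => // /(_ 0%N); rewrite dvdn0 => /(_ isT).
  split=> // p; rewrite leqNgt; apply/negP => lt1.
  have p_pr : prime p by move: lt1; rewrite lognE; case: (prime p).
  have /sqn p1 : (p ^ 2 %| n)%N by rewrite pfactor_dvdn.
  by rewrite p1 in p_pr.
have d0 : (0 < d)%N by move: (dvdn_gt0 n0 dn); rewrite expn_gt0 orbF.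
apply: eqn_from_log => // p; have := nlog p.
by have := dvdn_leq_log p n0 dn; rewrite lognX logn1; lia.
Qed.

Lemma squarefree_dvd (d n : nat) : (d %| n)%N -> squarefree n -> squarefree d.
Proof. by move=> dn sqn e /dvdn_trans /(_ dn) /sqn. Qed.

Lemma squarefreeM (m n : nat) :
  squarefree (m * n) <-> [/\ coprime m n, squarefree m & squarefree n].
Proof.
split=> [sqmn|[cop /squarefree_lognP[m0 mlog] /squarefree_lognP[n0 nlog]]].
  split; [|exact: squarefree_dvd (dvdn_mulr _ _) sqmn
          |exact: squarefree_dvd (dvdn_mull _ _) sqmn].
  by apply/eqP/sqmn; rewrite expnS expn1 dvdn_mul ?dvdn_gcdl ?dvdn_gcdr.
apply/squarefree_lognP; split=> [|p]; first by rewrite muln_gt0 m0.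
rewrite lognM //; have := logn_gcd p m0 n0; rewrite (eqP cop) logn1.
have := mlog p; have := nlog p; lia.
Qed.

Lemma exists_squarefree_part (n : nat) : (0 < n)%N ->
  exists s x : nat, squarefree s /\ n = (s * x ^ 2)%N.
Proof.
elim/ltn_ind: n => n IH n0.
have [sqn|] := pselect (squarefree n).
  by exists n, 1%N; rewrite muln1.
move=> /existsNP[d /not_implyP[/dvdnP[k nE] d1]].
move: n0; rewrite nE muln_gt0 => /andP[k0 d2].
have ltkn : (k < n)%N.
  rewrite nE ltn_Pmulr //; move: d1 d2.
  by case: d {nE} => [|[|d]] // _ _; rewrite (ltn_exp2r 1).
have [s [x [sqs ->]]] := IH k ltkn k0.
by exists s, (x * d)%N; rewrite expnMn mulnA.
Qed.

Lemma squarefree_part_inj (r s x y : nat) :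
  squarefree r -> squarefree s -> (0 < x)%N -> (0 < y)%N ->
  (r * x ^ 2 = s * y ^ 2)%N -> r = s.
Proof.
move=> /squarefree_lognP[r0 rlog] /squarefree_lognP[s0 slog] x0 y0 eq_rs.
apply: eqn_from_log => // p; have := congr1 (logn p) eq_rs.
rewrite !lognM ?muln_gt0 ?r0 ?s0 ?x0 ?y0 //.
have := rlog p; have := slog p; lia.
Qed.

(* [e] is the gcd of the squarefree parts [c * e] of [a] and [d * e] of [b]. *)
Lemma mul_eq_squarefree_mul_sqr (D a b k : nat) :
    squarefree D -> (0 < a)%N -> (0 < b)%N -> (a * b = D * k ^ 2)%N ->
  exists c d e x y : nat, [/\ D = (c * d)%N, coprime e D,
    a = (c * e * x ^ 2)%N & b = (d * e * y ^ 2)%N].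
Proof.
move=> sqD a0 b0 abE.
have [s [x [sqs aE]]] := exists_squarefree_part a0.
have [r [y [sqr bE]]] := exists_squarefree_part b0.
pose e := gcdn s r.
have e0 : (0 < e)%N by rewrite gcdn_gt0; case/squarefree_lognP: sqs => ->.
have [c sE] : exists c, s = (c * e)%N by apply/dvdnP/dvdn_gcdl.
have [d rE] : exists d, r = (d * e)%N by apply/dvdnP/dvdn_gcdr.
have [[cop_ce sqc _] [cop_de sqd _]] :
  [/\ coprime c e, squarefree c & squarefree e] /\
  [/\ coprime d e, squarefree d & squarefree e].
  by split; apply/squarefreeM; rewrite -?sE -?rE.
have cop_cd : coprime c d.
  by rewrite /coprime -(eqn_pmul2r e0) mul1n muln_gcdl -sE -rE.
have DE : D = (c * d)%N.
  apply/esym/(@squarefree_part_inj _ _ (e * x * y) k) => //.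
  - by apply/squarefreeM.
  - by move: a0 b0; rewrite aE bE; lia.
  - by move: a0 b0; case: k abE => //; nia.
  - by rewrite -abE aE bE sE rE; lia.
exists c, d, e, x, y; split; rewrite -?sE -?rE //.
by rewrite DE coprimeMr ![coprime e _]coprime_sym cop_ce.
Qed.

Lemma squarefree_eq_prime_dvd (c d : nat) : squarefree c -> squarefree d ->
  (forall p, prime p -> (p %| c) = (p %| d))%N -> c = d.
Proof.
move=> /squarefree_lognP[c0 clog] /squarefree_lognP[d0 dlog] eq_dvd.
apply: eqn_from_log => // p.
have : (0 < logn p c)%N = (0 < logn p d)%N.
  rewrite !logn_gt0 !mem_primes c0 d0 /=.
  by case: (boolP (prime p)) => // /eq_dvd ->.
have := clog p; have := dlog p.
by case: (logn p c) (logn p d) => [|[|i]] [|[|j]].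
Qed.

Lemma size_divisors_squarefree (n : nat) : squarefree n ->
  (size (divisors n) <= 2 ^ size (primes n))%N.
Proof.
move=> sqn; have /squarefree_lognP[n0 _] := sqn.
pose support d := map_tuple (dvdn^~ d) (in_tuple (primes n)).
have support_inj : {in divisors n &, injective support}.
  move=> c d; rewrite -!dvdn_divisors // => cn dn.
  move=> /(congr1 val) /eq_in_map eq_support.
  apply: squarefree_eq_prime_dvd => [||p p_pr];
    [exact: squarefree_dvd sqn | exact: squarefree_dvd sqn |].
  have [pn|pNn] := boolP (p %| n)%N.
    by apply: eq_support; rewrite mem_primes p_pr n0.
  have p_ndvd m : (m %| n)%N -> (p %| m)%N = false.
    by move=> mn; apply: contraNF pNn => /dvdn_trans; apply.
  by rewrite !p_ndvd.
rewrite -card_bool -card_tuple -(size_map support).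
by rewrite -(card_uniqP _) ?max_card // map_inj_in_uniq ?divisors_uniq.
Qed.

(** * Pairs of integers whose product lies in a given square class *)

Lemma ln_sub_ge (R : realType) (x y : R) : 0 < x -> 0 < y ->
  (y - x) / y <= ln y - ln x.
Proof.
move=> x0 y0; have xy0 : 0 < x / y by rewrite divr_gt0.
have : ln (1 + (x / y - 1)) <= x / y - 1 by apply: le_ln1Dx; lra.
by rewrite addrC subrK ln_div ?posrE // mulrBl divff ?gt_eqF //; lra.
Qed.

Lemma sum_inv_arith_prog_le (R : realType) (q n : nat) : (0 < q)%N ->
  \sum_(0 <= j < n.+1) ((j * q).+1%:R : R)^-1 <= 1 + ln (n * q).+1%:R / q%:R.
Proof.
move=> q0; elim: n => [|n IH]; first by rewrite big_nat1 invr1 ln1 mul0r addr0.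
rewrite big_nat_recr //= (le_trans (lerD IH (lexx _))) // -addrA lerD2l.
have := @ln_sub_ge R (n * q).+1%:R (n.+1 * q).+1%:R (ltr0Sn _ _) (ltr0Sn _ _).
rewrite -natrB ?ltnS ?leq_mul // subSS -mulnBl subSnn mul1n.
by rewrite -lerBrDl -mulrBl ler_pdivlMr ?ltr0n // mulrC.
Qed.

Lemma gcdn2E (n : nat) : gcdn 2 n = if odd n then 1%N else 2%N.
Proof.
case: ifPn => [odd_n|even_n]; last by apply/gcdn_idPl; rewrite dvdn2.
by apply/eqP; rewrite -/(coprime 2 n) coprime2n.
Qed.

Lemma coprime_dvdn_gcdn2_pred (e n : nat) : (0 < e)%N -> coprime e n ->
  (gcdn 2 n %| e.-1)%N.
Proof.
move=> e0 cop; rewrite gcdn2E; case: ifPn => [_|even_n]; first exact: dvd1n.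
have : coprime 2 e.
  by apply: coprime_dvdl (_ : 2 %| n)%N _; rewrite ?dvdn2 // coprime_sym.
by rewrite coprime2n dvdn2 -{1}(prednK e0).
Qed.

Lemma mem_iota_truncn_sqrt (R : realType) (X : R) (n z : nat) :
    (0 < n * z ^ 2)%N -> (n * z ^ 2)%:R <= X ->
  z \in iota 1 (Num.truncn (Num.sqrt (X / n%:R))).
Proof.
rewrite muln_gt0 expn_gt0 orbF => /andP[n0 z0] nzX.
rewrite mem_iota z0 add1n ltnS truncn_ge_nat ?sqrtr_ge0 //.
rewrite -(@ger0_norm _ z%:R) // -sqrtr_sqr ler_wsqrtr // ler_pdivlMr ?ltr0n //.
by rewrite mulrC -natrX -natrM.
Qed.

Section SquareClassPairs.
Variables (R : realType) (D : nat) (X : R).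

Let q := gcdn 2 D.

Definition square_class_grid (d e : nat) : seq (nat * nat) :=
  [seq (d * e * x ^ 2, D %/ d * e * y ^ 2)%N
    | x <- iota 1 (Num.truncn (Num.sqrt (X / (d * e)%:R))),
      y <- iota 1 (Num.truncn (Num.sqrt (X / (D %/ d * e)%:R)))].

Definition square_class_pairs : seq (nat * nat) :=
  flatten [seq square_class_grid d (j * q).+1
    | d <- divisors D, j <- index_iota 0 ((Num.truncn X).-1 %/ q).+1].

Lemma mem_square_class_pairs (a b k : nat) : squarefree D ->
    (0 < a)%N -> (0 < b)%N -> a%:R <= X -> b%:R <= X ->
    (a * b = D * k ^ 2)%N ->
  (a, b) \in square_class_pairs.
Proof.
move=> sqD a0 b0 aX bX abE; have /squarefree_lognP[D0 _] := sqD.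
have X0 : 0 <= X by apply: le_trans aX.
have [c [d [e [x [y [DE cop_eD aE bE]]]]]] :=
  mul_eq_squarefree_mul_sqr sqD a0 b0 abE.
have /andP[c0 e0] : (0 < c)%N && (0 < e)%N by move: a0; rewrite aE; lia.
have cD : (c %| D)%N by rewrite DE dvdn_mulr.
have dE : (D %/ c = d)%N by rewrite DE mulKn.
have eN : (e <= Num.truncn X)%N.
  rewrite truncn_ge_nat // (le_trans _ aX) // ler_nat dvdn_leq //.
  by rewrite aE mulnAC dvdn_mull.
have eE : (e.-1 %/ q * q).+1 = e.
  by rewrite divnK ?prednK // coprime_dvdn_gcdn2_pred.
apply/flattenP; exists (square_class_grid c e).
  apply/allpairsP; exists (c, (e.-1 %/ q)%N); rewrite /= eE -dvdn_divisors //.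
  by split=> //; rewrite mem_index_iota ltnS leq_div2r // -!subn1 leq_sub2r.
apply/allpairsP; exists (x, y); rewrite /= dE -aE -bE; split=> //.
  by apply: mem_iota_truncn_sqrt; rewrite -aE.
by apply: mem_iota_truncn_sqrt; rewrite -bE.
Qed.

Lemma size_square_class_grid_le (d e : nat) :
  0 <= X -> (d %| D)%N -> (0 < D)%N ->
  (size (square_class_grid d e))%:R <= X / Num.sqrt D%:R / e%:R.
Proof.
move=> X0 dD D0; rewrite size_allpairs !size_iota natrM.
set r := X / (d * e)%:R; set s := X / (D %/ d * e)%:R.
apply: (@le_trans _ _ (Num.sqrt r * Num.sqrt s)).
  by rewrite ler_pM // truncn_le sqrtr_ge0.
rewrite -sqrtrM ?divr_ge0 //.
have -> : r * s = (X / e%:R) ^+ 2 / D%:R.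
  by rewrite /r /s -{2}(divnK dD) !natrM !invfM; ring.
rewrite sqrtrM ?sqr_ge0 // sqrtr_sqr sqrtrV ?ler0n //.
by rewrite ger0_norm ?divr_ge0 // mulrAC.
Qed.

Lemma size_square_class_pairs_le : squarefree D -> 1 <= X ->
  (size square_class_pairs)%:R <=
  2 ^+ size (primes D) * (X / Num.sqrt D%:R) * (1 + ln X / q%:R).
Proof.
move=> sqD X1; have /squarefree_lognP[D0 _] := sqD.
have q0 : (0 < q)%N by rewrite gcdn_gt0.
have X0 : 0 <= X by lra.
have XD0 : 0 <= X / Num.sqrt D%:R by rewrite divr_ge0 ?sqrtr_ge0.
set n := ((Num.truncn X).-1 %/ q)%N.
have nX : (n * q).+1%:R <= X.
  rewrite -truncn_gt_nat -[ltnRHS]prednK ?truncn_gt0 // ltnS.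
  exact: leq_trunc_div.
rewrite size_flatten sumnE big_map big_allpairs_dep natr_sum.
apply: (@le_trans _ _ (\sum_(d <- divisors D) \sum_(0 <= j < n.+1)
    X / Num.sqrt D%:R / (j * q).+1%:R)).
  rewrite big_seq [leRHS]big_seq; apply: ler_sum => d.
  rewrite -dvdn_divisors // natr_sum => dD.
  by apply: ler_sum => j _; apply: size_square_class_grid_le.
under eq_bigr do rewrite -mulr_sumr.
rewrite big_const_seq count_predT iter_addr_0 -[leLHS]mulr_natl -[leRHS]mulrA.
rewrite ler_pM ?mulr_ge0 ?sumr_ge0 //.
  by rewrite -natrX ler_nat size_divisors_squarefree.
rewrite ler_wpM2l // (le_trans (sum_inv_arith_prog_le _ _ q0)) // lerD2l.
by rewrite ler_wpM2r ?invr_ge0 // ler_ln ?posrE //; lra.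
Qed.

End SquareClassPairs.

(** * Trace polynomials of palindromic polynomials *)

Fixpoint dickson (R : comNzRingType) (k : nat) : {poly R} :=
  match k with
  | 0 => 2%:P
  | 1 => 'X
  | (k2.+1 as k1).+1 => 'X * dickson R k1 - dickson R k2
  end.

Arguments dickson {R} k : simpl never.

Section TracePoly.
Variable R : comNzRingType.
Implicit Type f : {poly R}.

Lemma dicksonSS (k : nat) :
  dickson k.+2 = 'X * dickson k.+1 - dickson k :> {poly R}.
Proof. by []. Qed.

Lemma size_dickson_leq (k : nat) : (size (dickson k : {poly R}) <= k.+1)%N.
Proof.
elim/ltn_ind: k => -[|[|k]] IH; first by rewrite size_polyC_leq1.
  by rewrite size_polyX.
rewrite dicksonSS (leq_trans (size_polyD _ _)) // geq_max size_polyN.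
apply/andP; split; last by rewrite ltnW // ltnS (leq_trans (IH k _)) // ltnW.
by rewrite (leq_trans (size_polyMleq _ _)) // size_polyX add2n ltnS IH.
Qed.

Lemma coef_dickson_lead (k : nat) : (dickson k.+1 : {poly R})`_k.+1 = 1.
Proof.
elim: k => [|k IH]; first by rewrite coefX.
rewrite dicksonSS coefB coefXM IH [(dickson k)`__]nth_default ?subr0 //.
by rewrite (leq_trans (size_dickson_leq k)).
Qed.

Lemma horner_dickson (z w : R) (k : nat) : z * w = 1 ->
  (dickson k).[z + w] = z ^+ k + w ^+ k.
Proof.
move=> zw1; elim/ltn_ind: k => -[|[|k]] IH.
- by rewrite hornerC.
- by rewrite hornerX.
rewrite dicksonSS hornerD hornerN hornerM hornerX !IH // !exprS.
have -> : (z + w) * (z * z ^+ k + w * w ^+ k) =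
  z * (z * z ^+ k) + w * (w * w ^+ k) + z * w * (z ^+ k + w ^+ k) by ring.
by rewrite zw1 mul1r addrK.
Qed.

Definition palindromic (n : nat) f : Prop :=
  (size f <= n.+1)%N /\ forall k, (k <= n)%N -> f`_k = f`_(n - k).

(* For [f] palindromic of degree [2 * m], this is the polynomial [g] such that
   [f(z) = z^m g(z + 1/z)]. *)
Definition trace_poly (m : nat) f : {poly R} :=
  (f`_m)%:P + \sum_(k < m) f`_(m + k.+1) *: dickson k.+1.

Lemma size_trace_poly_leq (m : nat) f : (size (trace_poly m f) <= m.+1)%N.
Proof.
apply/leq_sizeP => j ltmj; rewrite coefD coefC gtn_eqF ?(leq_trans _ ltmj) //.
rewrite add0r coef_sum big1 // => k _.
rewrite coefZ [(dickson _)`__]nth_default ?mulr0 //.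
by rewrite (leq_trans (size_dickson_leq _)) // (leq_ltn_trans (ltn_ord k)).
Qed.

Lemma coef_trace_poly_lead (m : nat) f : (0 < m)%N ->
  (trace_poly m f)`_m = f`_(2 * m).
Proof.
case: m => // m _; rewrite coefD coefC /= add0r coef_sum big_ord_recr /=.
rewrite big1 ?add0r => [|k _]; rewrite coefZ.
  by rewrite coef_dickson_lead mulr1 mul2n addnn.
rewrite [(dickson _)`__]nth_default ?mulr0 //.
by rewrite (leq_trans (size_dickson_leq _)) // ltnS.
Qed.

Lemma size_trace_poly (m : nat) f : (0 < m)%N -> f`_(2 * m) = 1 ->
  size (trace_poly m f) = m.+1.
Proof.
move=> m0 f_lead; apply/eqP; rewrite eqn_leq size_trace_poly_leq ltnNge.
apply/negP => szm; have := coef_trace_poly_lead f m0.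
by rewrite nth_default // f_lead => /esym/eqP; rewrite oner_eq0.
Qed.

Lemma horner_trace_poly (m : nat) f (z w : R) : palindromic (2 * m) f ->
  z * w = 1 -> f.[z] = z ^+ m * (trace_poly m f).[z + w].
Proof.
move=> [szf pal] zw1; rewrite (horner_coef_wide _ szf).
have -> : (2 * m).+1 = (m + m.+1)%N by rewrite mul2n -addnn addnS.
rewrite big_split_ord /= (reindex_inj rev_ord_inj) /= big_ord_recl /= addn0.
rewrite hornerD hornerC horner_sum mulrDr addrCA mulrC; congr (_ + _).
rewrite -big_split mulr_sumr; apply: eq_bigr => k _ /=.
have ltkm := ltn_ord k.
rewrite hornerZ horner_dickson // /bump /= add1n.
rewrite (pal (m - k.+1)%N); last by lia.
have -> : (2 * m - (m - k.+1) = m + k.+1)%N by lia.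
have zmwk : z ^+ (m - k.+1) = z ^+ m * w ^+ k.+1.
  rewrite -[X in z ^+ X * _](subnK ltkm) exprD -mulrA -exprMn.
  by rewrite zw1 expr1n mulr1.
by rewrite exprD zmwk; ring.
Qed.

End TracePoly.

Section TracePolyMap.
Variables (R S : comNzRingType) (h : {rmorphism R -> S}).

Lemma map_dickson (k : nat) : map_poly h (dickson k) = dickson k.
Proof.
elim/ltn_ind: k => -[|[|k]] IH.
- by rewrite map_polyC /= rmorph_nat.
- by rewrite map_polyX.
by rewrite !dicksonSS rmorphB rmorphM /= map_polyX !IH.
Qed.

Lemma map_trace_poly (m : nat) (f : {poly R}) :
  map_poly h (trace_poly m f) = trace_poly m (map_poly h f).
Proof.
rewrite /trace_poly rmorphD rmorph_sum /= map_polyC /= coef_map; congr (_ + _).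
by apply: eq_bigr => k _; rewrite map_polyZ /= map_dickson coef_map.
Qed.

Lemma palindromic_map (n : nat) (f : {poly R}) :
  palindromic n f -> palindromic n (map_poly h f).
Proof.
move=> [szf pal]; split=> [|k kn]; first exact: leq_trans (size_poly _ _) szf.
by rewrite !coef_map pal.
Qed.

End TracePolyMap.

Lemma trace_poly_inj (R : idomainType) (m : nat) (f g : {poly R}) :
  palindromic (2 * m) f -> palindromic (2 * m) g ->
  trace_poly m f = trace_poly m g -> f = g.
Proof.
move=> pal_f pal_g eq_fg; apply/eqP; rewrite -tofrac_eq.
pose lift : {rmorphism R -> {fraction {poly R}}} := @tofrac {poly R} \o polyC.
pose x := tofrac ('X : {poly R}).
have xV : x * x^-1 = 1 by rewrite divff // tofrac_eq0 polyX_eq0.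
have tofracE p : tofrac p = (map_poly lift p).[x].
  by rewrite map_poly_comp horner_map -[p in LHS]comp_polyXr.
rewrite !tofracE (horner_trace_poly (palindromic_map lift pal_f) xV).
rewrite (horner_trace_poly (palindromic_map lift pal_g) xV).
by rewrite -!map_trace_poly eq_fg.
Qed.

Lemma poly_eq_in_seq (R : idomainType) (p q : {poly R}) (rs : seq R) :
    uniq rs -> {in rs, forall x, p.[x] = q.[x]} ->
    (forall k, (size rs <= k)%N -> p`_k = q`_k) ->
  p = q.
Proof.
move=> uniq_rs eq_rs eq_coef; apply/eqP; rewrite -subr_eq0; apply/eqP.
apply: (roots_geq_poly_eq0 _ uniq_rs).
  by apply/allP => x /eq_rs eq_x; rewrite rootE hornerD hornerN eq_x subrr.
by apply/leq_sizeP => k le_k; rewrite coefB eq_coef ?subrr.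
Qed.

Lemma root_trace_poly (F : fieldType) (m : nat) (f : {poly F}) (z : F) :
  palindromic (2 * m) f -> z != 0 -> root f z ->
  root (trace_poly m f) (z + z^-1).
Proof.
move=> pal z0; rewrite !rootE (horner_trace_poly pal (divff z0)).
by rewrite mulf_eq0 expf_eq0 (negPf z0) andbF.
Qed.

(** * Polynomials of Salem numbers *)

Lemma addrV_inj (F : fieldType) (z w : F) : z != 0 -> w != 0 ->
  z + z^-1 = w + w^-1 -> z = w \/ z = w^-1.
Proof.
move=> z0 w0 eq_zw.
have /eqP : (z - w) * (1 - (z * w)^-1) = 0.
  transitivity ((z + z^-1) - (w + w^-1)); last by rewrite eq_zw subrr.
  by field; rewrite z0 w0.
rewrite mulf_eq0 !subr_eq0 => /orP[/eqP ->|/eqP zwV]; [by left | right].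
have zw1 : z * w = 1 by rewrite -[z * w]invrK -zwV invr1.
by rewrite -[z](mulfK w0) zw1 mul1r.
Qed.

Lemma addrV_unit_circle (R : rcfType) (z : R[i]) : `|z| = 1 ->
  z + z^-1 = (2 * complex.Re z)%:C%C.
Proof.
by move=> z1; rewrite invC_norm z1 expr1n invr1 mul1r addcJ rmorphM rmorph_nat.
Qed.

Lemma norm_Re_unit_circle_lt (R : rcfType) (z : R[i]) :
  `|z| = 1 -> z \isn't Num.real -> `|2 * complex.Re z| < 2.
Proof.
case: z => a b; rewrite normc_def complex_real /= => /complexI ab1 b_neq0.
have ab : a ^+ 2 + b ^+ 2 = 1.
  by rewrite -[LHS]sqr_sqrtr ?ab1 ?expr1n // addr_ge0 ?sqr_ge0.
have b2 : 0 < b ^+ 2 by rewrite exprn_even_gt0.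
by rewrite ltr_norml; apply/andP; split; nra.
Qed.

Lemma reciprocal_palindromic (m : nat) (f : {poly int}) :
  reciprocal_of m f -> palindromic (2 * m) f.
Proof. by case. Qed.

Lemma root_trace_poly_real (R : rcfType) (m : nat) (f : {poly int}) (x : R)
    (z : R[i]) :
  palindromic (2 * m) f -> z != 0 -> x%:C%C = z + z^-1 ->
  root (map_poly intr f) z -> root (trace_poly m (map_poly intr f)) x.
Proof.
move=> pal z0 xE rootz; rewrite -(fmorph_root (real_complex R)) /= xE.
rewrite map_trace_poly -map_poly_comp.
rewrite (eq_map_poly (_ : _ =1 intr)) => [|k]; last exact: rmorph_int.
by apply: root_trace_poly => //; apply: palindromic_map.
Qed.

Lemma uniq_root_list_addrV_inj (R : realType) (n : nat) (lam : R)
    (mu : 'I_n -> R[i]) :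
  (forall i, mu i != 0) -> uniq (root_list lam mu) ->
  injective (fun i => mu i + (mu i)^-1).
Proof.
move=> mu0; rewrite /root_list !cat_uniq.
case/and3P=> _ _ /and3P[/injectiveP mu_inj /hasPn muV_notin _] i j.
move=> /(addrV_inj (mu0 i) (mu0 j))[/mu_inj //|muij].
have /muV_notin/negP[] : mu i \in [seq (mu k)^-1 | k : 'I_n].
  by apply/mapP; exists j; rewrite ?mem_enum.
by rewrite map_f ?mem_enum.
Qed.

Lemma trace_poly_salem_factor (R : realType) (m : nat) (Q : R)
    (f : {poly int}) :
    (0 < m)%N -> reciprocal_of m f -> salem_roots m Q f ->
  exists (alpha : R) (tau : 'I_(m - 1) -> R),
    [/\ 2 < alpha, alpha <= Q + 1, forall i, `|tau i| < 2 &
        trace_poly m (map_poly intr f) =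
          \prod_(z <- alpha :: codom tau) ('X - z%:P)].
Proof.
move=> m0 f_recip [lam [mu [lam1 lamQ mu_nreal mu1 [uniq_rs rootE]]]].
have pal := reciprocal_palindromic f_recip.
have lam0 : lam != 0 by rewrite gt_eqF //; lra.
have lamV : lam * lam^-1 = 1 by rewrite divff.
have mu0 i : mu i != 0 by rewrite -normr_eq0 mu1 oner_eq0.
pose alpha := lam + lam^-1; pose tau i := 2 * complex.Re (mu i).
have alpha2 : 2 < alpha by rewrite /alpha; nra.
have tau2 i : `|tau i| < 2 by exact: norm_Re_unit_circle_lt.
have tauE i : (tau i)%:C%C = mu i + (mu i)^-1 by rewrite addrV_unit_circle.
have tau_inj : injective tau.
  move=> i j eq_tau; apply: (uniq_root_list_addrV_inj mu0 uniq_rs).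
  by rewrite -!tauE eq_tau.
have f_lead : (map_poly intr f : {poly R})`_(2 * m) = 1.
  by rewrite coef_map; case: f_recip => _ _ _ ->.
have size_trace := size_trace_poly m0 f_lead.
exists alpha, tau; split=> //; first by rewrite /alpha; nra.
rewrite [LHS](@all_roots_prod_XsubC _ _ (alpha :: codom tau)).
- by rewrite lead_coefE size_trace coef_trace_poly_lead // f_lead scale1r.
- by rewrite size_trace /= size_codom card_ord; lia.
- apply/andP; split.
    apply: (root_trace_poly_real (z := lam%:C%C) pal); rewrite ?fmorph_eq0 //.
      by rewrite rmorphD /= fmorphV.
    by rewrite rootE inE eqxx.
  apply/allP => _ /codomP[i ->].
  apply: (root_trace_poly_real pal (mu0 i)) => //.
  by rewrite rootE !mem_cat map_f ?mem_enum ?orbT.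
- rewrite uniq_rootsE /= map_inj_uniq ?enum_uniq // andbT.
  apply/codomP => -[i alphaE]; have := tau2 i.
  by rewrite -alphaE ltr_norml; lra.
Qed.

Lemma prodr_gt0_le_exp (R : realDomainType) (n : nat) (E : 'I_n -> R) (c : R) :
  (forall i, 0 < E i <= c) -> 0 < \prod_i E i <= c ^+ n.
Proof.
move=> Ec; rewrite prodr_gt0 => [|i _]; last by case/andP: (Ec i).
rewrite -[n in c ^+ n]card_ord -prodr_const; apply: ler_prod => i _.
by have /andP[/ltW -> ->] := Ec i.
Qed.

Lemma norm_coef_prod_XsubC_le (R : numDomainType) (rs : seq R) (k : nat) :
  `|(\prod_(z <- rs) ('X - z%:P))`_k| <= \prod_(z <- rs) (1 + `|z|).
Proof.
elim: rs k => [|z rs IH] k.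
  by rewrite !big_nil coef1; case: (k == 0%N); rewrite ?normr1 ?normr0.
rewrite !big_cons mulrBl coefB coefXM coefCM mulrDl mul1r.
rewrite (le_trans (ler_normB _ _)) // lerD ?normrM ?ler_wpM2l //.
by case: k => [|k] //=; rewrite normr0 prodr_ge0 // => i _; rewrite addr_ge0.
Qed.

Section SalemBounds.
Variables (R : realType) (m : nat) (Q : R) (f : {poly int}).
Hypotheses (m_gt0 : (0 < m)%N) (f_recip : reciprocal_of m f).
Hypothesis f_salem : salem_roots m Q f.

Let pal_R : palindromic (2 * m) (map_poly intr f : {poly R}).
Proof. exact/palindromic_map/reciprocal_palindromic. Qed.

Lemma horner_sign_salem (s : R) : s * s = 1 ->
  exists alpha c : R, [/\ 2 < alpha <= Q + 1, 0 < c <= 4 ^+ (m - 1) &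
    (map_poly intr f).[s] = (2 - s * alpha) * c].
Proof.
move=> ss1; have [alpha [tau [alpha2 alphaQ tau2 trace_f]]] :=
  trace_poly_salem_factor m_gt0 f_recip f_salem.
exists alpha, (\prod_i (2 - s * tau i)); split; first by rewrite alpha2.
  have s_sign : (s == 1) || (s == -1) by rewrite -sqrf_eq1 expr2 ss1.
  apply: prodr_gt0_le_exp => i; have := tau2 i; rewrite ltr_norml.
  by case/orP: s_sign => /eqP ->; lra.
have horner_factor z : ('X - z%:P).[s + s] = s * (2 - s * z).
  by rewrite hornerXsubC mulrBr mulrA ss1; ring.
rewrite (horner_trace_poly pal_R ss1) trace_f horner_prod big_cons big_image.
under eq_bigr do rewrite horner_factor.
rewrite horner_factor big_split prodr_const card_ord /=.
have := congr1 (fun u => u ^+ (m - 1)) ss1; rewrite expr1n exprMn => ssm1.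
rewrite -{1}(subnK m_gt0) exprD expr1.
by move: (s ^+ _) (\prod_i _) ssm1 => u c uu1; ring: ss1 uu1.
Qed.

Lemma horner1_salem_bounds :
  (0 : R) < - (f.[1])%:~R <= 4 ^+ (m - 1) * (Q + 3).
Proof.
have [alpha [c [/andP[alpha2 alphaQ] /andP[c0 c4]]]] :=
  horner_sign_salem (mulr1 1).
rewrite -[X in _.[X]](rmorph1 intr) horner_map /= => ->.
have -> : - ((2 - 1 * alpha) * c) = c * (alpha - 2) by ring.
by rewrite mulr_gt0 ?subr_gt0 //= ler_pM //; lra.
Qed.

Lemma hornerN1_salem_bounds :
  (0 : R) < (f.[-1])%:~R <= 4 ^+ (m - 1) * (Q + 3).
Proof.
have N1N1 : -1 * -1 = 1 :> R by rewrite mulN1r opprK.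
have [alpha [c [/andP[alpha2 alphaQ] /andP[c0 c4]]]] := horner_sign_salem N1N1.
rewrite -[X in _.[X]](rmorphN1 intr) horner_map /= => ->.
have -> : (2 - -1 * alpha) * c = c * (alpha + 2) by ring.
by rewrite mulr_gt0 //= ?ler_pM //; lra.
Qed.

Lemma norm_coef_trace_poly_salem_le (k : nat) :
  `|(trace_poly m f)`_k|%:~R <= 3 ^+ (m - 1) * (Q + 2) :> R.
Proof.
have [alpha [tau [alpha2 alphaQ tau2 trace_f]]] :=
  trace_poly_salem_factor m_gt0 f_recip f_salem.
rewrite intr_norm -(coef_map intr) map_trace_poly trace_f.
apply: le_trans (norm_coef_prod_XsubC_le _ _) _.
rewrite big_cons big_image mulrC.
have /andP[p0 p3] : 0 < \prod_i (1 + `|tau i|) <= 3 ^+ (m - 1).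
  apply: prodr_gt0_le_exp => i.
  by have := tau2 i; have := normr_ge0 (tau i); lra.
by rewrite ler_pM ?(ltW p0) //; rewrite ger0_norm; lra.
Qed.

End SalemBounds.

Lemma squarefree_mul_sqr_rat (D n : nat) (k : rat) : squarefree D ->
  n%:R = D%:R * k ^+ 2 -> exists j : nat, n = (D * j ^ 2)%N.
Proof.
move=> sqD nE; set p := `|numq k|%N; set q := `|denq k|%N.
have sqrE (z : int) : (`|z|%N%:R : rat) ^+ 2 = z%:~R ^+ 2.
  by rewrite natr_absz intr_norm real_normK ?num_real.
have npq : (n * q ^ 2 = D * p ^ 2)%N.
  apply/eqP; rewrite -(eqr_nat rat) (natrM _ n) (natrM _ D) !natrX nE !sqrE.
  rewrite -mulrA -exprMn; apply/eqP; congr (_ * _ ^+ 2).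
  by rewrite -{1}(divq_num_den k) divfK // intr_eq0 denq_neq0.
have cop : coprime (q ^ 2) (p ^ 2).
  by rewrite coprimeXl // coprimeXr // coprime_sym coprime_num_den.
have /sqD q1 : (q ^ 2 %| D)%N by rewrite -(Gauss_dvdl _ cop) -npq dvdn_mull.
by exists p; rewrite -npq q1 exp1n muln1.
Qed.

Lemma card_fset_set_le_size (T : choiceType) (U : eqType) (A : set T)
    (code : T -> U) (s : seq U) :
    set_inj A code -> (forall x, A x -> code x \in s) ->
  finite_set A /\ (#|` fset_set A|%fset <= size s)%N.
Proof.
move=> code_inj code_in.
have As : (A #<= `I_(size s))%card.
  have /injfunPex[g] :
      exists2 g : T -> nat, set_fun A `I_(size s) g & set_inj A g.
    exists (fun x => index (code x) s) => [x Ax|x y Ax Ay eq_index].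
      by rewrite /= index_mem code_in.
    apply: code_inj => //; rewrite !inE in Ax Ay.
    by rewrite -(nth_index (code x) (code_in x Ax)) eq_index nth_index ?code_in.
  exact: inj_card_le g.
by split; [apply/finite_set_leP; exists (size s) | exact: geq_card_fset_set].
Qed.

Section CountFset.
Variables (R : realType) (m D : nat) (Q : R).
Hypotheses (m_gt1 : (1 < m)%N) (D_sqf : squarefree D).

Let m_gt0 : (0 < m)%N := ltnW m_gt1.
Let X : R := 4 ^+ (m - 1) * (Q + 3).
Let M := Num.truncn (3 ^+ (m - 1) * (Q + 2)).

Lemma Fset_horner_sign (f : {poly int}) : Fset m D Q f ->
  f.[1] < 0 /\ 0 < f.[-1].
Proof.
case=> f_recip _ _ f_salem.
have /andP[f1 _] := horner1_salem_bounds m_gt0 f_recip f_salem.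
have /andP[fN1 _] := hornerN1_salem_bounds m_gt0 f_recip f_salem.
by move: f1 fN1; rewrite oppr_gt0 ltrz0 ltr0z.
Qed.

Lemma Fset_horner_pair (f : {poly int}) : Fset m D Q f ->
  (`|f.[1]|, `|f.[-1]|)%N \in square_class_pairs D X.
Proof.
move=> Ff; have [f1 fN1] := Fset_horner_sign Ff.
case: Ff => f_recip _ [k kE] f_salem.
have /andP[_ f1X] := horner1_salem_bounds m_gt0 f_recip f_salem.
have /andP[_ fN1X] := hornerN1_salem_bounds m_gt0 f_recip f_salem.
have [j jE] : exists j : nat, (`|f.[1]| * `|f.[-1]| = D * j ^ 2)%N.
  apply: (@squarefree_mul_sqr_rat _ _ k) => //.
  rewrite natrM !natr_absz (ltr0_norm f1) (gtr0_norm fN1) -intrM mulNr mulrNz.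
  by rewrite kE opprK.
apply: (mem_square_class_pairs D_sqf _ _ _ _ jE).
- by rewrite absz_gt0 lt_eqF.
- by rewrite absz_gt0 gt_eqF.
- by rewrite natr_absz ltr0_norm ?mulrNz.
- by rewrite natr_absz gtr0_norm.
Qed.

Lemma Fset_eq (f g : {poly int}) : Fset m D Q f -> Fset m D Q g ->
    f.[1] = g.[1] -> f.[-1] = g.[-1] ->
    (forall k, (2 <= k < m)%N -> (trace_poly m f)`_k = (trace_poly m g)`_k) ->
  f = g.
Proof.
move=> [f_recip _ _ _] [g_recip _ _ _] eq1 eqN1 eq_coef.
have pal_f := reciprocal_palindromic f_recip.
have pal_g := reciprocal_palindromic g_recip.
apply: (trace_poly_inj pal_f pal_g).
apply: (@poly_eq_in_seq _ _ _ [:: 1 + 1; -1 - 1]) => // [x|k k2].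
- rewrite !inE => /orP[] /eqP ->.
    have := eq1; rewrite (horner_trace_poly pal_f (mulr1 1)).
    by rewrite (horner_trace_poly pal_g (mulr1 1)) expr1n !mul1r.
  have N1N1 : -1 * -1 = 1 :> int by [].
  apply: (@mulfI _ ((-1) ^+ m)); first by rewrite signr_eq0.
  by rewrite -(horner_trace_poly pal_f N1N1) -(horner_trace_poly pal_g N1N1).
- have [km|mk|->] := ltngtP k m; first by rewrite eq_coef // k2.
    by rewrite !nth_default // (leq_trans (size_trace_poly_leq _ _)).
  rewrite !coef_trace_poly_lead //.
  by case: f_recip g_recip => _ _ _ -> [_ _ _ ->].
Qed.

Lemma card_Fset_le : 1 < Q ->
  finite_set (Fset m D Q) /\
  (#|` fset_set (Fset m D Q)|%fset
     <= size (square_class_pairs D X) * (2 * M).+1 ^ (m - 2))%N.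
Proof.
move=> Q1.
pose coefs (f : {poly int}) :=
  [ffun k : 'I_(m - 2) =>
    inord `|(trace_poly m f)`_(k + 2) + M%:Z| : 'I_(2 * M).+1].
pose code f := ((`|f.[1]|, `|f.[-1]|)%N, coefs f).
have coef_M f k : Fset m D Q f -> `|(trace_poly m f)`_k| <= M%:Z.
  case=> f_recip _ _ f_salem; rewrite -abszE lez_nat truncn_ge_nat.
    by rewrite pmulrn; apply: norm_coef_trace_poly_salem_le f_salem k.
  by rewrite mulr_ge0 ?exprn_ge0 //; lra.
have -> : ((2 * M).+1 ^ (m - 2) =
    size (enum {: {ffun 'I_(m - 2) -> 'I_(2 * M).+1}}))%N.
  by rewrite -cardE card_ffun !card_ord.
rewrite -(size_allpairs pair); apply: (@card_fset_set_le_size _ _ _ code).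
  move=> f g; rewrite !inE => Ff Fg [eq1 eqN1 /ffunP eq_coefs].
  have [f1 fN1] := Fset_horner_sign Ff; have [g1 gN1] := Fset_horner_sign Fg.
  apply: (Fset_eq Ff Fg) => [||k /andP[k2 km]].
  - by apply: oppr_inj; rewrite -(ltr0_norm f1) -(ltr0_norm g1) -!abszE eq1.
  - by rewrite -(gtr0_norm fN1) -(gtr0_norm gN1) -!abszE eqN1.
  have lt_k : (k - 2 < m - 2)%N by lia.
  have := congr1 val (eq_coefs (Ordinal lt_k)); rewrite !ffunE /= subnK //.
  have := coef_M f k Ff; have := coef_M g k Fg.
  move: ((trace_poly m f)`_k : int) ((trace_poly m g)`_k : int) => x y.
  by move=> xM yM; rewrite !inordK; lia.
move=> f Ff; apply/allpairsP; exists (code f); split=> //=.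
  exact: Fset_horner_pair.
by rewrite mem_enum.
Qed.

End CountFset.

(** * Lower bound for [kappa0] *)

Lemma leq_succ_mul_exp3 (n : nat) : (n.+1 * 3 ^ n <= 2 * 4 ^ n)%N.
Proof.
elim: n => [|[|[|n]] IH] //; rewrite (expnS 3) (expnS 4).
by move: IH; move: (3 ^ _)%N (4 ^ _)%N => x y; nia.
Qed.

Lemma leq_exp3_fact_half_exp4 (n : nat) :
  (2 ^ n * 3 ^ (n.+1 * n) * (n.+1./2)`! ^ 2 <= 4 ^ (n.+1 * n) * 2 ^ n.+1./2)%N.
Proof.
elim: n => [|n IH] //.
have expS b : (b ^ (n.+2 * n.+1) = b ^ (n.+1 * n) * (b ^ n.+1) ^ 2)%N.
  by rewrite -expnM -expnD; congr expn; lia.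
have xy := leq_succ_mul_exp3 n.+1; rewrite !expS (expnS 2 n).
move: (3 ^ n.+1)%N (4 ^ n.+1)%N xy => x y xy.
move: (3 ^ _)%N (4 ^ _)%N (2 ^ n)%N IH => s t p IH.
have [n_odd|n_even] := boolP (odd n).
  have -> : n.+2./2 = n.+1./2 by lia.
  have xy2 : (2 * x ^ 2 <= y ^ 2)%N.
    have : (3 * x <= 2 * y)%N by apply: leq_trans xy; rewrite leq_mul //; lia.
    by rewrite -leq_sqr !expnMn; lia.
  move: (2 ^ _)%N (_`!) IH => q r IH.
  by have := leq_mul IH xy2; lia.
have -> : n.+2./2 = n.+1./2.+1 by lia.
have xy2 : ((n.+1./2.+1 * x) ^ 2 <= y ^ 2)%N.
  rewrite leq_sqr -(@leq_pmul2l 2) // (leq_trans _ xy) // mulnA leq_mul2r.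
  by apply/orP; right; lia.
rewrite factS (expnS 2 n.+1./2).
move: (2 ^ _)%N (_`!) (n.+1./2.+1) xy2 IH => q r h xy2 IH.
by have := leq_mul IH xy2; lia.
Qed.

Lemma exp4E (R : pzSemiRingType) (n : nat) : 4 ^+ n = 2 ^+ (2 * n) :> R.
Proof. by rewrite exprM -[2 ^+ 2]natrX. Qed.

Lemma exp2_sub_ge (R : realDomainType) (c k n : nat) : (c <= 2 ^ k)%N ->
  2 ^+ (k * n) <= (2 ^+ k.+1 - c%:R) ^+ n :> R.
Proof.
rewrite -(ler_nat R) natrX => c_le.
have sub_ge : 2 ^+ k <= 2 ^+ k.+1 - c%:R :> R by rewrite exprS; lra.
by rewrite exprM lerXn2r ?nnegrE ?(le_trans _ sub_ge) ?exprn_ge0.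
Qed.

Lemma kappa0_ge_exp4_div_fact (R : realType) (m : nat) : (1 < m)%N ->
  4 ^+ ((m - 1) * (m - 2)) * 2 ^+ (m - 1)./2 / ((m - 1)./2)`!%:R ^+ 2
    <= kappa0 R m.
Proof.
move=> m1.
have leq_exp2 i j : (i <= j)%N -> (2 ^ i <= 2 ^ j)%N by rewrite leq_exp2l.
rewrite /kappa0; have [m_odd|m_even] := boolP (odd m).
  have [h mE] : exists h, m = (2 * h + 3)%N by exists (m - 3)./2; lia.
  have -> : (m - 3)./2 = h by lia.
  have -> : (m - 1)./2 = h.+1 by lia.
  have -> : (2 * m - 1 = (4 * h + 4).+1)%N by lia.
  have -> : (m - 1 = 2 * h + 2)%N by lia.
  have -> : (m - 2 = 2 * h + 1)%N by lia.
  rewrite ler_wpM2r ?invr_ge0 ?exprn_ge0 // exp4E -exprD.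
  have -> : (2 * ((2 * h + 2) * (2 * h + 1)) + h.+1 =
    (4 * h + 4).+1 * h.+1 + (4 * h + 4) * h)%N by lia.
  by rewrite exprD ler_wpM2l ?exprn_ge0 // exp2_sub_ge // (leq_exp2 1); lia.
have [h mE] : exists h, m = (2 * h + 2)%N by exists (m./2 - 1)%N; lia.
have -> : (m./2 - 1 = h)%N by lia.
have -> : (m - 1)./2 = h by lia.
have -> : (2 * m = (4 * h + 3).+1)%N by lia.
have -> : (m - 1 = 2 * h + 1)%N by lia.
have -> : (m - 2 = 2 * h)%N by lia.
rewrite ler_wpM2r ?invr_ge0 ?exprn_ge0 // exp4E -exprD.
have -> : (2 * ((2 * h + 1) * (2 * h)) + h =
  (2 * h + 1) * (2 * h) + (4 * h + 3) * h)%N by lia.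
by rewrite exprD ler_wpM2l ?exprn_ge0 // exp2_sub_ge // (leq_exp2 2); lia.
Qed.

Lemma kappa0_ge (R : realType) (m : nat) : (1 < m)%N ->
  (2 * 3 ^+ (m - 1)) ^+ (m - 2) <= kappa0 R m.
Proof.
move=> m1; apply: le_trans (kappa0_ge_exp4_div_fact R m1).
have := leq_exp3_fact_half_exp4 (m - 2); rewrite -(ler_nat R).
have -> : (m - 2).+1 = (m - 1)%N by lia.
rewrite ler_pdivlMr ?exprn_gt0 ?ltr0n ?fact_gt0 // exprMn -exprM.
by rewrite (natrM R (_ * _)%N) natrM (natrM R (4 ^ _)) !natrX.
Qed.

Lemma kappaE (R : realType) (m D : nat) : (0 < m)%N ->
  kappa R m D = (if odd D then 4 else 3)
    * (2 ^+ size (primes D) * 4 ^+ (m - 1)) * kappa0 R m.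
Proof.
move=> m0; rewrite /kappa; set t := size _.
have -> : (t + 2 * m - 2 = t + 2 * (m - 1))%N by lia.
have -> : (t + 2 * m = 2 + (t + 2 * (m - 1)))%N by lia.
by rewrite exp4E -exprD (exprD _ 2) -[2 ^+ 2]natrX; case: ifP.
Qed.

(** * Asymptotics *)

Lemma exprD_le_lead (R : realDomainType) (x b : R) (n : nat) :
  1 <= x -> 0 <= b ->
  (x + b) ^+ n.+1 <= x ^+ n.+1 + ((1 + b) ^+ n.+1 - 1) * x ^+ n.
Proof.
move=> x1 b0; have x0 : 0 <= x by lra.
elim: n => [|n IH]; first by rewrite !expr1 expr0; lra.
rewrite exprS (le_trans (ler_wpM2l _ IH)) ?addr_ge0 //.
have : 0 <= b * ((1 + b) ^+ n.+1 - 1) * x ^+ n * (x - 1).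
  by rewrite !mulr_ge0 ?exprn_ge0 ?subr_ge0 // exprn_ege1 // lerDl.
rewrite [(1 + b) ^+ n.+2]exprS [x ^+ n.+2]exprS [x ^+ n.+1]exprS.
by move: ((1 + b) ^+ n.+1) (x ^+ n) => c y; lra.
Qed.

Lemma exprD_mul_ln_le_lead (R : realType) (b K c : R) (n : nat) :
    0 <= b -> 0 <= K -> 0 <= c ->
  exists C : R, forall x : R, 1 < x ->
    (x + b) ^+ n.+1 * (K + c * ln x) <= c * x ^+ n.+1 * ln x + C * x ^+ n.+1.
Proof.
move=> b0 K0 c0; set B := (1 + b) ^+ n.+1 - 1.
have B0 : 0 <= B by rewrite subr_ge0 exprn_ege1 // lerDl.
exists (K + B * (K + c)) => x x1; have x0 : 0 < x by lra.
have lnx0 : 0 <= ln x by rewrite ln_ge0 // ltW.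
have lnx_le : K + c * ln x <= (K + c) * x.
  by rewrite mulrDl lerD ?ler_wpM2l ?ler_peMr ?(ltW (ln_sublinear _)) // ltW.
apply: (@le_trans _ _ ((x ^+ n.+1 + B * x ^+ n) * (K + c * ln x))).
  by rewrite ler_wpM2r ?exprD_le_lead ?addr_ge0 ?mulr_ge0 // ltW.
have : B * x ^+ n * (K + c * ln x) <= B * x ^+ n * ((K + c) * x).
  by rewrite ler_wpM2l // mulr_ge0 // exprn_ge0 // ltW.
by rewrite exprS; move: (x ^+ n) (ln x) => y l; lra.
Qed.

Definition square_class_density (R : realType) (m D : nat) : R :=
  2 ^+ size (primes D) * 4 ^+ (m - 1) / Num.sqrt D%:R.

Section CardFset.
Variables (R : realType) (m D : nat).
Hypotheses (m_gt1 : (1 < m)%N) (D_sqf : squarefree D).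

Let q : R := (gcdn 2 D)%:R.
Let P := square_class_density R m D.
Let A : R := 2 * 3 ^+ (m - 1).

Lemma size_square_class_pairs_le_ln (Q : R) : 1 < Q ->
  (size (square_class_pairs D (4 ^+ (m - 1) * (Q + 3))))%:R <=
    P * (Q + 3) * (1 + ln (4 ^+ m) / q + q^-1 * ln Q).
Proof.
move=> Q1; set X := 4 ^+ (m - 1) * (Q + 3).
have X1 : 1 <= X by rewrite -[leLHS]mulr1 ler_pM ?exprn_ege1 //; lra.
have lnX : ln X <= ln (4 ^+ m) + ln Q.
  rewrite -lnM ?posrE ?exprn_gt0 //; last by lra.
  rewrite ler_ln ?posrE ?mulr_gt0 ?exprn_gt0 //; try lra.
  rewrite /X -[in leRHS](subnK (ltnW m_gt1)) exprD expr1 -mulrA.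
  by rewrite ler_wpM2l ?exprn_ge0 //; lra.
apply: (le_trans (size_square_class_pairs_le D_sqf X1)).
have -> : P * (Q + 3) = 2 ^+ size (primes D) * (X / Num.sqrt D%:R).
  by rewrite /P /square_class_density /X; ring.
rewrite ler_wpM2l ?mulr_ge0 ?exprn_ge0 ?invr_ge0 ?sqrtr_ge0 //; first by lra.
by rewrite -addrA lerD2l [q^-1 * _]mulrC -mulrDl ler_wpM2r // invr_ge0 ler0n.
Qed.

Lemma card_Fset_le_ln (Q : R) : 1 < Q ->
  (#|` fset_set (Fset m D Q)|%fset)%:R <=
    P * A ^+ (m - 2) *
      ((Q + 3) ^+ (m - 2).+1 * (1 + ln (4 ^+ m) / q + q^-1 * ln Q)).
Proof.
move=> Q1; have [_] := card_Fset_le m_gt1 D_sqf Q1.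
set M := Num.truncn _; rewrite -(ler_nat R) natrM natrX => /le_trans; apply.
have pow3 : 1 <= 3 ^+ (m - 1) :> R by rewrite exprn_ege1 //; lra.
have coefs_le : (2 * M).+1%:R <= A * (Q + 3).
  have : M%:R <= 3 ^+ (m - 1) * (Q + 2) by rewrite truncn_le mulr_ge0 //; lra.
  by rewrite -[(2 * M).+1%:R]natr1 natrM /A; lra.
set Kln := _ + q^-1 * ln Q.
have -> : P * A ^+ (m - 2) * ((Q + 3) ^+ (m - 2).+1 * Kln) =
    P * (Q + 3) * Kln * (A * (Q + 3)) ^+ (m - 2).
  by rewrite [(Q + 3) ^+ _.+1]exprS [(A * (Q + 3)) ^+ _]exprMn; ring.
apply: ler_pM.
- exact: ler0n.
- by rewrite exprn_ge0 ?ler0n.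
- exact: size_square_class_pairs_le_ln.
- by rewrite lerXn2r // nnegrE ?(le_trans _ coefs_le) ?ler0n.
Qed.

Lemma square_class_density_le_kappa :
  P * A ^+ (m - 2) / q <= kappa R m D / (pi * Num.sqrt D%:R).
Proof.
have [sqD0 pi0] : 0 < Num.sqrt (D%:R : R) /\ 0 < pi :> R.
  by have /squarefree_lognP[D0 _] := D_sqf; rewrite sqrtr_gt0 ltr0n pi_gt0.
have q0 : 0 < q by rewrite ltr0n gcdn_gt0.
have pi4 : pi <= 4 :> R by have := pihalf_lt2 R; lra.
rewrite ler_pdivlMr ?mulr_gt0 // kappaE ?(ltnW m_gt1) //.
have -> : P * A ^+ (m - 2) / q * (pi * Num.sqrt D%:R) =
    pi / q * (2 ^+ size (primes D) * 4 ^+ (m - 1)) * A ^+ (m - 2).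
  by rewrite /P /square_class_density; field; rewrite (gt_eqF sqD0) gt_eqF.
have tX_ge0 : 0 <= 2 ^+ size (primes D) * 4 ^+ (m - 1) :> R.
  by rewrite mulr_ge0 ?exprn_ge0.
apply: ler_pM; last exact: kappa0_ge.
- by rewrite mulr_ge0 // divr_ge0 // ltW.
- by rewrite exprn_ge0 // mulr_ge0 ?exprn_ge0.
by rewrite ler_wpM2r // /q gcdn2E; case: ifP => _; lra.
Qed.

End CardFset.

Theorem theorem4p5 (R : realType) (m D : nat)
  (m_gt0 : (0 < m)%N) (m_neq1 : m <> 1%N)
  (D_gt0 : (0 < D)%N) (D_sqf : squarefree D) :
  exists C : R, forall Q : R, 1 < Q ->
    finite_set (Fset m D Q) /\
    (#|` fset_set (Fset m D Q)|%fset)%:R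
      <= kappa R m D / (pi * Num.sqrt D%:R) * Q ^+ (m - 1) * ln Q
         + C * Q ^+ (m - 1).
Proof.
have m_gt1 : (1 < m)%N by lia.
pose q : R := (gcdn 2 D)%:R.
have q0 : 0 <= q^-1 by rewrite invr_ge0 ler0n.
have K0 : 0 <= 1 + ln (4 ^+ m) / q.
  by rewrite addr_ge0 ?mulr_ge0 ?ln_ge0 ?exprn_ege1 //; lra.
have [C HC] := exprD_mul_ln_le_lead (m - 2) (ler0n R 3) K0 q0.
pose P : R := square_class_density R m D * (2 * 3 ^+ (m - 1)) ^+ (m - 2).
have P0 : 0 <= P.
  by rewrite !mulr_ge0 ?exprn_ge0 ?invr_ge0 ?sqrtr_ge0 // mulr_ge0 ?exprn_ge0.
exists (P * C) => Q Q1; split; first by case: (card_Fset_le m_gt1 D_sqf Q1).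
have -> : (m - 1 = (m - 2).+1)%N by lia.
apply: (le_trans (card_Fset_le_ln m_gt1 D_sqf Q1)).
apply: (le_trans (ler_wpM2l P0 (HC Q Q1))); rewrite mulrDr !mulrA lerD2r.
apply: ler_wpM2r; first by rewrite ln_ge0 // ltW.
apply: ler_wpM2r; first by rewrite exprn_ge0 //; lra.
exact: square_class_density_le_kappa.
Qed.
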